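(* Let $\alpha_1,\alpha_2\in(0,1)$, $\lambda,\mu>0$, and let $L^{\alpha_1,\alpha_2}_{\lambda,\mu}$ be the Mittag-Leffler GI/GI/1 queue length. Then: \begin{enumerate} \item If $\alpha_1<\alpha_2$, then $\mathbb P\{L^{\alpha_1,\alpha_2}_{\lambda,\mu}(t)=0\ \text{i.o.}\}=1$. \item If $\alpha_1>\alpha_2$, then $\mathbb P\{\limsup_{t\to\infty}L^{\alpha_1,\alpha_2}_{\lambda,\mu}(t)=\infty\}=1$. \end{enumerate}
   Context: Mittag-Leffler function: $E_{a,b}(x)=\sum_{\ell\ge 0}\frac{x^{\ell}}{\Gamma(b+a\ell)}$. For $\alpha\in(0,1)$ and $\lambda>0$, a Mittag-Leffler random variable $X_{\alpha,\lambda}$ with index $\alpha$ and scale $\lambda$ is positive with $\mathbb P\{X_{\alpha,\lambda}>x\}=E_{\alpha,1}(-\lambda^{\alpha}x^{\alpha})$, $x\ge0$. The fractional Poisson process $N^{(\alpha)}_{\lambda}(t)$ is the renewal counting process with $N^{(\alpha)}_\lambda(0)=0$ whose inter-event times are i.i.d. copies of $X_{\alpha,\lambda}$ (the first one starting at time $0$). Mittag-Leffler GI/GI/1 queue: the arrival process $N^{(\alpha_1)}_{\lambda}$ and the departure (service) process $N^{(\alpha_2)}_{\mu}$ are independent fractional Poisson processes, and the queue length is $$L^{\alpha_1,\alpha_2}_{\lambda,\mu}(t)=\big(N^{(\alpha_1)}_{\lambda}(t)-N^{(\alpha_2)}_{\mu}(t)\big)-\inf_{0\le s\le t}\big(N^{(\alpha_1)}_{\lambda}(s)-N^{(\alpha_2)}_{\mu}(s)\big),\qquad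 t\ge0.$$ The event $\{L(t)=0\ \text{i.o.}\}$ (infinitely often) means that $L(t)=0$ for arbitrarily large times $t$, i.e. $\{t\ge0:L(t)=0\}$ is unbounded. *)

(* Defs.v *)
From mathcomp Require Import all_boot all_order all_algebra.
From mathcomp Require Import all_classical all_reals all_analysis.
From mathcomp Require Import measurable_realfun.

Set Implicit Arguments.
Unset Strict Implicit.
Unset Printing Implicit Defensive.

Import Order.TTheory GRing.Theory Num.Theory.
Import numFieldNormedType.Exports.

Local Open Scope classical_set_scope.
Local Open Scope ring_scope.

(* Euler's Gamma function; only meaningful for [0 < s]. *)
Definition Gamma (R : realType) (s : R) : R :=
  \int[@lebesgue_measure R]_(t in `]0, +oo[) (t `^ (s - 1) * expR (- t)).

Definition mittag_leffler (R : realType) (a b x : R) : R :=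
  limn (series (fun l : nat => x ^+ l / Gamma (b + a * l%:R))).

Section random_variables.
Context (d : measure_display) (T : measurableType d) (R : realType).
Variable P : probability T R.

Definition mittag_leffler_rv (a lambda : R) (X : {RV P >-> R}) : Prop :=
  {ae P, forall w, 0 < X w} /\
  forall x : R, 0 <= x ->
    P [set w | x < X w] =
    (mittag_leffler a 1 (- (lambda `^ a * x `^ a)))%:E.

Definition mutually_independent (X : nat -> {RV P >-> R}) : Prop :=
  forall (s : seq nat) (B : nat -> set R),
    uniq s -> (forall i, measurable (B i)) ->
    P (\big[setI/setT]_(i <- s) (X i @^-1` B i)) =
    (\prod_(i <- s) P (X i @^-1` B i))%E.

(* [renewal_count X t w] is the supremum of the [n] such that
   [X 0 w + ... + X n.-1 w <= t].  Its values are extended reals because the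
   supremum is [+oo] where infinitely many renewals occur before [t]; for
   Mittag-Leffler inter-event times this happens with probability 0. *)
Definition renewal_count (X : nat -> T -> R) (t : R) (w : T) : \bar R :=
  ereal_sup [set (n%:R)%:E | n in [set n : nat | \sum_(i < n) X i w <= t]].

(* The behaviour of [N t] at negative times is left unconstrained. *)
Definition fractional_poisson_process (a lambda : R) (N : R -> T -> \bar R) :
    Prop :=
  exists X : nat -> {RV P >-> R},
    [/\ mutually_independent X,
        forall n, mittag_leffler_rv a lambda (X n) &
        forall t w, 0 <= t -> N t w = renewal_count X t w].

Definition process_sigma_algebra (N : R -> T -> \bar R) : set (set T) :=
  <<s [set A | exists t : R, 0 <= t /\
         exists B : set (\bar R), measurable B /\ A = N t @^-1` B] >>.

Definition independent_processes (N M : R -> T -> \bar R) : Prop :=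
  forall A B : set T,
    process_sigma_algebra N A -> process_sigma_algebra M B ->
    P (A `&` B) = (P A * P B)%E.

End random_variables.

Definition queue_length (T : Type) (R : realType) (N M : R -> T -> \bar R)
    (t : R) (w : T) : \bar R :=
  ((N t w - M t w) -
   ereal_inf [set (N s w - M s w)%E | s in [set s : R | (0 <= s <= t)%R]])%E.

(* Main.v *)
Require Import Defs.
From mathcomp Require Import all_boot all_order all_algebra.
From mathcomp Require Import all_classical all_reals all_analysis.
From mathcomp Require Import measurable_realfun.
From mathcomp Require Import ring lra zify.

Set Implicit Arguments.
Unset Strict Implicit.
Unset Printing Implicit Defensive.

Import Order.TTheory GRing.Theory Num.Theory.
Import numFieldNormedType.Exports.

Local Open Scope classical_set_scope.
Local Open Scope ring_scope.

(** Only the tails of the inter-event times matter, and they decay like powers: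
    for a Mittag-Leffler variable of index [a], [P (X > x)] is of exact order
    [x `^ (- a)].  Hence [n] renewals take a time of order [n `^ (1 / a)], and
    of the two counting processes the one with the smaller index grows more
    slowly.  At the time [n `^ (2 / (a + b))], for indices [a < b], the process
    of index [a] has fewer than [n] renewals and that of index [b] at least
    [2 n], up to a probability tending to 0; therefore almost surely both hold
    at once for infinitely many [n] ([renewals_apart]).

    If the arrivals have the smaller index, the net input is thus unbounded
    below.  The queue is empty whenever the net input reaches a new minimum,
    which must then happen after any given time ([queue_empties]).  If the
    services have the smaller index, the net input is unbounded above, and the
    queue length is at least the net input ([queue_length_ge]).

    The tail [f] of [X] is known only through a power series, which says
    nothing directly about large arguments.  The bridge is the fractional
    integral equation [mittag_leffler_integral_eq]: with [c] the constant
    [lambda `^ a / Gamma a],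
      [1 - f x = c * \int_0^x (x - v) `^ (a - 1) * f v dv],
    which the Beta integral gives term by term.  Since [f] is a tail, it is
    nonnegative and nonincreasing, and this turns the equation into two-sided
    bounds: the kernel is at least [x `^ (a - 1)], so the integral of [f] up to
    [x] is at most of order [x `^ (1 - a)] ([truncated_tail_integral_le]);
    and for large [x] the right-hand side is close to 1, of which the integral
    up to a small fraction [d * x] accounts for little, so [f (d * x)], the
    largest value of [f] on the rest, cannot be smaller than a multiple of
    [x `^ (- a)] ([tail_ge_powR]).

    The integrated bound is the expectation of [X] truncated at [x], and gives
    an upper bound on the tail of a sum by the Markov inequality
    ([prob_sum_gt_le]); the lower bound and independence show that among [n]
    variables one is likely to exceed [t] by itself ([prob_sum_le_le]). *)

(** * Gamma and Beta integrals *)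

(** The image of Lebesgue measure under an increasing affine map, scaled by the
    slope, agrees with Lebesgue measure on intervals, hence everywhere. *)
Lemma ge0_integral_affine {R : realType} (k c : R) (f : R -> \bar R) :
  0 < k -> measurable_fun setT f -> (forall x, 0 <= f x)%E ->
  (\int[@lebesgue_measure R]_x f x =
   k%:E * \int[@lebesgue_measure R]_x f (k * x + c)%R)%E.
Proof.
move=> k0 mf f0; pose phi (x : measurableTypeR R) : measurableTypeR R :=
  k * x + c.
have mphi : measurable_fun setT phi.
  by apply: measurable_funD => //; exact: mulrl_measurable.
pose nu := mscale (NngNum (ltW k0)) (pushforward (@lebesgue_measure R) phi).
have nuE : forall A, measurable A -> @lebesgue_measure R A = nu mphi A.
  apply: lebesgue_measure_unique => _ [[a b] _ <-].
  have phiE : phi @^-1` `]a, b]%classic = `](a - c) / k, (b - c) / k]%classic.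
    apply/seteqP; split => x /=; rewrite !in_itv /= => /andP[h1 h2];
    by move: h1 h2; rewrite ltr_pdivrMr// ler_pdivlMr// ltrBlDr lerBrDr mulrC
      => -> ->.
  transitivity (k%:E * @lebesgue_measure R (phi @^-1` `]a, b]%classic))%E;
    last by [].
  rewrite phiE.
  rewrite !lebesgue_measure_itv /= !lte_fin ltr_pM2r ?invr_gt0// ltrD2r.
  case: ifPn => [ab|_]; last by rewrite mule0.
  by rewrite -!EFinB -EFinM; congr EFin; field; rewrite gt_eqF.
transitivity (\int[nu mphi]_x f x)%E.
  by apply: eq_measure_integral => A mA _; exact: nuE.
rewrite ge0_integral_mscale//=; congr (_ * _)%E.
by rewrite (@ge0_integral_pushforward _ _ _ _ _ _ mphi).
Qed.

Section gamma_integral.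
Context {R : realType}.
Local Notation mu := (@lebesgue_measure R).
Implicit Types (b x z : R).

(** The integrand may be unbounded at 0, so the fundamental theorem of calculus
    is applied on the intervals from [1 / (n + 2)] to 1, which exhaust the
    domain. *)
Lemma integral_powR_le1 b : -1 < b ->
  (\int[mu]_(x in `]0%R, 1%R]) (x `^ b)%:E <= ((b + 1)^-1)%:E)%E.
Proof.
move=> b1; have b10 : 0 < b + 1 by rewrite -ltrBlDr sub0r.
pose F (n : nat) : set R := `[n.+2%:R^-1, 1]%classic.
have ltF n : n.+2%:R^-1 < 1 :> R by rewrite invf_lt1// ltr1n.
have F0 n x : F n x -> 0 < x.
  by rewrite /F /= in_itv /= => /andP[+ _]; apply: lt_le_trans; rewrite invr_gt0.
have mp (D : set R) : measurable_fun D (fun x => (x `^ b)%:E).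
  by apply/measurable_EFinP; apply: measurable_funTS; exact: measurable_powR.
have -> : `]0, 1]%classic = \bigcup_n F n.
  apply/seteqP; split => x /=.
    rewrite in_itv /= => /andP[x0 x1].
    have [N _ HN] := near_infty_natSinv_lt (PosNum x0).
    exists N => //; rewrite /F /= in_itv /= x1 andbT.
    by apply: ltW; apply: (HN N.+1) => /=.
  move=> [n _ Fx]; rewrite in_itv /= (F0 _ _ Fx) /=.
  by move: Fx; rewrite /F /= in_itv /= => /andP[].
have cF : (\int[mu]_(x in F n) (x `^ b)%:E)%E @[n --> \oo] -->
    (\int[mu]_(x in \bigcup_n F n) (x `^ b)%:E)%E.
  apply: ge0_nondecreasing_set_cvg_integral => //.
  - move=> m n mn; apply/subsetPset => x; rewrite /F /= !in_itv /= => /andP[h ->].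
    by rewrite andbT (le_trans _ h)// lef_pV2 ?posrE// ler_nat !ltnS.
  - by move=> n; exact: measurable_itv.
  - by move=> n; exact: mp.
  - by move=> n x _; rewrite lee_fin powR_ge0.
rewrite -(cvg_lim _ cF)//; apply: lime_le; first by apply/cvg_ex; eexists;
  exact: cF.
apply: nearW => n; rewrite /F.
pose G x := (b + 1)^-1 * x `^ (b + 1).
have dG x : 0 < x -> derivable G x 1.
  move=> x0; apply: derivableM; first exact: derivable_cst.
  by apply: derivable_powR; rewrite in_itv /= x0.
have cG x : 0 < x -> {for x, continuous G}.
  by move=> x0; apply/differentiable_continuous/derivable1_diffP/dG.
have n0 : 0 < n.+2%:R^-1 :> R by rewrite invr_gt0.
rewrite (@continuous_FTC2 _ _ G)//.
- rewrite /G powR1 mulr1 -EFinB lee_fin gerBl mulr_ge0// ?powR_ge0//.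
  by rewrite invr_ge0 ltW.
- apply: derivable_within_continuous => x; rewrite in_itv /= => /andP[h _].
  by apply: derivable_powR; rewrite in_itv /= (lt_le_trans _ h).
- split.
  + by move=> x; rewrite in_itv /= => /andP[h _]; apply: dG; exact: lt_trans h.
  + by apply: cvg_at_right_filter; apply: cG.
  + by apply: cvg_at_left_filter; apply: cG.
- move=> x; rewrite in_itv /= => /andP[h _].
  have x0 : 0 < x by exact: lt_trans h.
  have dp : derivable (fun y : R => y `^ (b + 1)) x 1 by apply: derivable_powR;
    rewrite in_itv /= x0.
  rewrite /G derive1Ml// powR_derive1 ?in_itv /= ?x0//.
  by rewrite mulrA mulVf ?gt_eqF// mul1r addrK.
Qed.

(** Extending the power function by zero to the negative half line turns the
    Euler integrals into integrals over the whole line, on which translations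
    and dilations act without moving the domain. *)
Definition pos_pow b x : R := if 0 < x then x `^ b else 0.

Lemma pos_pow_ge0 b x : 0 <= pos_pow b x.
Proof. by rewrite /pos_pow; case: ifP => // _; exact: powR_ge0. Qed.

Lemma measurable_pos_pow b : measurable_fun setT (pos_pow b).
Proof.
rewrite /pos_pow; apply: measurable_fun_ifT => //.
exact: measurable_fun_ltr.
Qed.

Lemma pos_powZ b k x : 0 < k -> pos_pow b (k * x) = k `^ b * pos_pow b x.
Proof.
move=> k0; rewrite /pos_pow pmulr_rgt0//.
by case: ifPn => [x0|]; rewrite ?mulr0// powRM// ltW.
Qed.

(** Indexed by the exponent of the integrand: this is the Gamma function at
    [b + 1], kept in the extended reals until it is known to be finite. *)
Definition gamma_integral b : \bar R :=
  (\int[mu]_x (pos_pow b x * expR (- x))%:E)%E.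

Lemma measurable_gamma_integrand b :
  measurable_fun setT (fun x : R => (pos_pow b x * expR (- x))%:E).
Proof.
apply/measurable_EFinP; apply: measurable_funM; first exact: measurable_pos_pow.
by apply: measurableT_comp => //; exact: measurable_funN.
Qed.

Lemma Gamma_gamma_integral s : Gamma s = fine (gamma_integral (s - 1)) :> R.
Proof.
rewrite /Gamma /gamma_integral /Rintegral integral_mkcond; congr fine;
  apply: eq_integral => x _.
rewrite patchE /pos_pow; case: ifPn => [|].
  by rewrite inE /= in_itv /= andbT => ->.
by rewrite notin_setE /= in_itv /= andbT => /negP/negbTE ->; rewrite mul0r.
Qed.

(** Raising [x / (2 * b) <= expR (x / (2 * b))] to the power [b]. *)
Lemma powR_le_expR_half b x : 0 < b -> 0 < x ->
  x `^ b <= (2 * b) `^ b * expR (x / 2).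
Proof.
move=> b0 x0; have b2 : 0 < 2 * b by rewrite mulr_gt0.
have q0 : 0 < x / (2 * b) by rewrite divr_gt0.
have xE : x = 2 * b * (x / (2 * b)) by rewrite mulrC divfK ?gt_eqF.
rewrite [in leLHS]xE (powRM _ (ltW b2) (ltW q0)) ler_pM2l ?powR_gt0//.
have -> : expR (x / 2) = expR (x / (2 * b)) `^ b.
  rewrite -expRM; congr expR; field; rewrite gt_eqF//=.
apply: ge0_ler_powR; rewrite ?nnegrE ?expR_ge0 ?(ltW b0) ?(ltW q0)//.
by apply: le_trans (expR_ge1Dx _); rewrite lerDr.
Qed.

(** Near 0 the power is integrable; beyond 1 it is dominated by a multiple of
    [expR (x / 2)], which leaves the density of an exponential law of rate 1/2. *)
Lemma gamma_integral_lty b : -1 < b -> (gamma_integral b < +oo)%E.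
Proof.
move=> b1; (* the exponent is raised to at least 1 to make it positive *)
pose m := Num.max b 1.
have m0 : 0 < m by rewrite lt_max ltr01 orbT.
pose u x : R := pos_pow b x * \1_(`]0, 1]%classic : set R) x.
pose v x : R := (2 * m) `^ m * 2 * exponential_pdf (2^-1) x.
have u0 x : 0 <= u x by rewrite mulr_ge0// ?pos_pow_ge0.
have K0 : 0 <= (2 * m) `^ m * 2 by rewrite mulr_ge0// powR_ge0.
have v0 x : 0 <= v x by rewrite mulr_ge0// exponential_pdf_ge0// invr_ge0.
have mu' : measurable_fun setT u.
  by apply: measurable_funM; [exact: measurable_pos_pow|exact: measurable_indic].
have mv : measurable_fun setT v.
  apply: measurable_funM => //.
  by apply: measurable_exponential_pdf.
apply: (@le_lt_trans _ _ (\int[mu]_x ((u x)%:E + (v x)%:E)))%E.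
  apply: ge0_le_integral => //.
  - by move=> x _; rewrite lee_fin mulr_ge0// ?pos_pow_ge0// expR_ge0.
  - exact: measurable_gamma_integrand.
  - by apply: emeasurable_funD; exact/measurable_EFinP.
  move=> x _; rewrite -EFinD lee_fin.
  have [x0|x0] := leP x 0.
    by rewrite {1}/pos_pow ltNge x0 mul0r addr_ge0.
  have vE : v x = (2 * m) `^ m * expR (x / 2) * expR (- x).
    rewrite /v exponential_pdfE ?ltW// -!mulrA; congr (_ * _).
    by rewrite mulrA divff// mul1r -expRD; congr expR; field.
  have [x1|x1] := leP x 1.
    apply: ler_wpDr => //; rewrite /u indicE mem_set /= ?in_itv /= ?x0 ?x1//.
    rewrite mulr1 ler_piMr ?pos_pow_ge0// -[leRHS]expR0 ler_expR oppr_le0 ltW//.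
  apply: ler_wpDl => //; rewrite vE ler_pM2r ?expR_gt0// /pos_pow x0.
  apply: le_trans (powR_le_expR_half m0 x0).
  by apply: ler_powR; [exact: ltW|rewrite le_max lexx].
rewrite ge0_integralD//; try exact/measurable_EFinP; try by move=> x _;
  rewrite lee_fin.
apply: lte_add_pinfty.
  apply: le_lt_trans (ltry (b + 1)^-1); apply: le_trans (integral_powR_le1 b1).
  rewrite [leRHS]integral_mkcond; rewrite le_eqVlt; apply/orP; left; apply/eqP;
    apply: eq_integral => x _.
  rewrite /u patchE indicE; case: ifPn => [|_]; last by rewrite mulr0.
  by rewrite inE /= in_itv /= /pos_pow => /andP[-> _]; rewrite mulr1.
rewrite /v; under eq_integral do rewrite EFinM.
rewrite ge0_integralZl//.
- by rewrite integral_exponential_pdf ?invr_gt0// mule1 ltry.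
- by apply/measurable_EFinP; exact: measurable_exponential_pdf.
- by move=> x _; rewrite lee_fin exponential_pdf_ge0// invr_ge0.
Qed.

(** The contribution of the interval from [M] to [M + 1]; the freedom in [M] is
    what makes this a lower bound on the growth of the Gamma function. *)
Lemma gamma_integral_lb b c M : 0 <= M -> 0 <= c ->
  (forall x, M < x -> x < M + 1 -> c <= x `^ b) ->
  ((c * expR (- (M + 1)))%:E <= gamma_integral b)%E.
Proof.
move=> M0 c0 cx.
pose I : set R := `]M, M + 1[%classic.
have mI : mu I = 1%E.
  by rewrite /I lebesgue_measure_itv /= lte_fin ltrDl ltr01 -EFinB addrAC subrr
    add0r.
have -> : (c * expR (- (M + 1)))%:E = (\int[mu]_(x in I) (c * expR (- (M +
  1)))%:E)%E.
  rewrite (@integral_cst _ _ _ mu I (measurable_itv _) (c * expR (- (M + 1)))%:E).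
  by rewrite -[LHS]mule1; congr (_ * _)%E; exact/esym/mI.
rewrite integral_mkcond; apply: ge0_le_integral => //.
- by move=> x _; apply: erestrict_ge0 => y _; rewrite lee_fin mulr_ge0 ?expR_ge0.
- by apply/(measurable_restrictT _ (measurable_itv _)).
- exact: measurable_gamma_integrand.
move=> x _; rewrite patchE; case: ifPn => [|_].
  rewrite inE /I /= in_itv /= => /andP[Mx xM].
  rewrite lee_fin ler_pM ?expR_ge0// ?ler_expR ?lerN2 ?(ltW xM)//.
  by rewrite /pos_pow (le_lt_trans M0 Mx) cx.
by rewrite lee_fin mulr_ge0 ?pos_pow_ge0 ?expR_ge0.
Qed.

Lemma gamma_integral_gt0 b : (0 < gamma_integral b)%E.
Proof.
have c0 : 0 < 2 `^ (- `|b|) :> R by rewrite powR_gt0.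
apply: (@lt_le_trans _ _ (2 `^ (- `|b|) * expR (- (1 + 1)))%:E).
  by rewrite lte_fin mulr_gt0// expR_gt0.
apply: gamma_integral_lb => [//||x x1 x2]; first by rewrite powR_ge0.
have x0 : 0 < x by exact: lt_trans x1.
have [b0|b0] := leP 0 b.
  apply: (@le_trans _ _ 1).
    by rewrite powRN ger0_norm// invf_le1 ?powR_gt0// -[leLHS](powRr0 2)
      ler_powR// ler1n.
  by rewrite -[leLHS](powRr0 x) ler_powR// ltW.
rewrite ltr0_norm// opprK -{2}(opprK b) -[X in 2 `^ X](opprK b) [2 `^ _]powRN
  [x `^ _]powRN.
rewrite lef_pV2 ?posrE ?powR_gt0//.
by apply: ge0_ler_powR; rewrite ?nnegrE ?oppr_ge0 ?(ltW b0) ?(ltW x0) ?(ltW x2).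
Qed.

End gamma_integral.

Section beta_convolution.
Context {R : realType}.
Local Notation mu := (@lebesgue_measure R).
Implicit Types (a b x z : R).

(** Additive convolution of two truncated powers; at [z = 1] it is the Beta
    integral. *)
Definition beta_conv a b z : \bar R :=
  (\int[mu]_v (pos_pow a (z - v) * pos_pow b v)%:E)%E.

Lemma measurable_beta_integrand a b z :
  measurable_fun setT (fun v : R => (pos_pow a (z - v) * pos_pow b v)%:E).
Proof.
apply/measurable_EFinP; apply: measurable_funM; last exact: measurable_pos_pow.
apply: measurableT_comp; first exact: measurable_pos_pow.
exact: measurable_funB.
Qed.

(** Homogeneity: substitute [v = z * u]. *)
Lemma beta_convE a b z :
  beta_conv a b z = ((pos_pow (a + b + 1) z)%:E * beta_conv a b 1)%E.
Proof.
have [z0|z0] := leP z 0.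
  rewrite /pos_pow ltNge z0 mul0e /beta_conv integral0_eq// => v _.
  rewrite /pos_pow subr_gt0; case: ifPn => [vz|]; last by rewrite mul0r.
  by rewrite ltNge (le_trans (ltW vz) z0) mulr0.
rewrite {1}/beta_conv (ge0_integral_affine 0 z0); last 2 first.
- exact: measurable_beta_integrand.
- by move=> x; rewrite lee_fin mulr_ge0 ?pos_pow_ge0.
under eq_integral => v _.
  rewrite addr0 -[X in X - z * v]mulr1 -mulrBr !pos_powZ//.
  rewrite mulrACA EFinM; over.
rewrite ge0_integralZl//; last 3 first.
- exact: measurable_beta_integrand.
- by move=> x _; rewrite lee_fin mulr_ge0 ?pos_pow_ge0.
- by rewrite lee_fin mulr_ge0 ?powR_ge0.
rewrite muleA -EFinM /pos_pow z0; congr (_%:E * _)%E.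
rewrite !powRD ?(gt_eqF z0) ?implybT// powRr1 ?ltW//; ring.
Qed.

(** Multiplying the two Euler integrals and integrating along the lines on
    which the sum of the two variables is constant. *)
Lemma gamma_integralM a b :
  (gamma_integral a * gamma_integral b =
   beta_conv a b 1 * gamma_integral (a + b + 1))%E.
Proof.
pose F z v : \bar R := (expR (- z) * (pos_pow a (z - v) * pos_pow b v))%:E.
have F0 z v : (0 <= F z v)%E.
  by rewrite lee_fin mulr_ge0 ?expR_ge0// mulr_ge0 ?pos_pow_ge0.
have mF : measurable_fun setT
    (fun p : measurableTypeR R * measurableTypeR R => F p.1 p.2).
  apply/measurable_EFinP; apply: measurable_funM.
    by apply: measurableT_comp => //; exact: measurable_funN.
  apply: measurable_funM.
    apply: measurableT_comp; first exact: measurable_pos_pow.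
    exact: measurable_funB.
  by apply: measurableT_comp => //; exact: measurable_pos_pow.
have horizontal z : (\int[mu]_v F z v = (expR (- z))%:E * beta_conv a b z)%E.
  rewrite /F; under eq_integral do rewrite EFinM.
  apply: ge0_integralZl => //; first exact: measurable_beta_integrand.
  by move=> x _; rewrite lee_fin mulr_ge0 ?pos_pow_ge0.
have vertical v : (\int[mu]_z F z v =
    (pos_pow b v * expR (- v))%:E * gamma_integral a)%E.
  rewrite (ge0_integral_affine v ltr01)//; last first.
    apply/measurable_EFinP; apply: measurable_funM.
      by apply: measurableT_comp => //; exact: measurable_funN.
    apply: measurable_funM => //.
    by apply: measurableT_comp;
      [exact: measurable_pos_pow|exact: measurable_funB].
  rewrite mul1e -ge0_integralZl//; last 3 first.
  - exact: measurable_gamma_integrand.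
  - by move=> x _; rewrite lee_fin mulr_ge0 ?expR_ge0 ?pos_pow_ge0.
  - by rewrite lee_fin mulr_ge0 ?expR_ge0 ?pos_pow_ge0.
  apply: eq_integral => u _; rewrite /F mul1r addrK -EFinM opprD expRD.
  by congr EFin; ring.
have fub : (\int[mu]_z \int[mu]_v F z v = \int[mu]_v \int[mu]_z F z v)%E.
  exact: (fubini_tonelli _ mF (fun p => F0 p.1 p.2)).
transitivity (\int[mu]_v \int[mu]_z F z v)%E.
  rewrite muleC {1}/gamma_integral -ge0_integralZr; last 4 first.
  - by [].
  - exact: measurable_gamma_integrand.
  - by move=> x _; rewrite lee_fin mulr_ge0 ?expR_ge0 ?pos_pow_ge0.
  - exact/ltW/gamma_integral_gt0.
  by apply: eq_integral => v _; rewrite vertical.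
rewrite -fub; under eq_integral do rewrite horizontal.
rewrite muleC {1}/gamma_integral -ge0_integralZr; last 4 first.
- by [].
- exact: measurable_gamma_integrand.
- by move=> x _; rewrite lee_fin mulr_ge0 ?expR_ge0 ?pos_pow_ge0.
- by apply: integral_ge0 => v _; rewrite lee_fin mulr_ge0 ?pos_pow_ge0.
apply: eq_integral => z _; rewrite beta_convE muleA -EFinM.
by congr (_%:E * _)%E; exact: mulrC.
Qed.

Lemma gamma_integral_fin_num b : -1 < b -> gamma_integral b \is a fin_num.
Proof.
by move=> b1; rewrite ge0_fin_numE ?gamma_integral_lty// ltW// gamma_integral_gt0.
Qed.

Lemma Gamma_gt0 s : 0 < s -> 0 < Gamma s :> R.
Proof.
move=> s0; rewrite Gamma_gamma_integral fine_gt0// gamma_integral_gt0.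
by rewrite gamma_integral_lty// ltrBrDr addNr.
Qed.

(** Dividing [gamma_integralM] by the Gamma factor on its right, which is finite
    and positive; this also shows that the Beta integral is finite. *)
Lemma beta_conv_Gamma a b z : -1 < a -> -1 < b ->
  beta_conv a b z =
  (pos_pow (a + b + 1) z *
   (Gamma (a + 1) * Gamma (b + 1) / Gamma (a + b + 2)))%:E.
Proof.
move=> a1 b1; have ab1 : -1 < a + b + 1 by lra.
have gammaE (c : R) : -1 < c -> gamma_integral c = (Gamma (c + 1))%:E.
  by move=> c1; rewrite Gamma_gamma_integral addrK fineK //;
    exact: gamma_integral_fin_num.
have -> : a + b + 2 = a + b + 1 + 1 by ring.
have G0 : 0 < Gamma (a + b + 1 + 1) :> R by apply: Gamma_gt0; lra.
have := gamma_integralM a b; rewrite (beta_convE _ _ z) !gammaE//.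
case: (beta_conv a b 1) => [r| |].
- rewrite -!EFinM => -[->]; by rewrite mulfK ?gt_eqF.
- by rewrite gt0_mulye ?lte_fin.
- by rewrite gt0_mulNye ?lte_fin.
Qed.

End beta_convolution.

(** * The Mittag-Leffler function and its fractional integral equation *)

Section mittag_leffler.
Context {R : realType}.
Local Notation mu := (@lebesgue_measure R).
Variable a : R.
Hypothesis a0 : 0 < a.
Implicit Types (x y v : R).

Let Gamma_al_gt0 l : 0 < Gamma (1 + a * l%:R) :> R.
Proof. by apply: Gamma_gt0; rewrite ltr_wpDr// mulr_ge0// ltW. Qed.

(** Since the Gamma integral over [M, M + 1] alone exceeds
    M ^ (s - 1) * exp (- M - 1) for every M, the coefficients of the series
    beat any geometric sequence. *)
Lemma mittag_leffler_term_geometric y : 0 <= y ->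
  exists2 C, 0 <= C & forall l, y ^+ l / Gamma (1 + a * l%:R) <= C * 2^-1 ^+ l.
Proof.
move=> y0; (* chosen so that [y / M `^ a] is at most 1/2 *)
pose M := (2 * y + 1) `^ a^-1.
have y21 : 0 < 2 * y + 1 by lra.
have M0 : 0 < M by rewrite powR_gt0.
have Ma : M `^ a = 2 * y + 1.
  by rewrite -powRrM mulVf ?gt_eqF// powRr1 ?ltW.
exists (expR (M + 1)); first exact: expR_ge0.
move=> l; rewrite ler_pdivrMr//.
have lb : M `^ (a * l%:R) * expR (- (M + 1)) <= Gamma (1 + a * l%:R).
  rewrite Gamma_gamma_integral addrAC subrr add0r -lee_fin fineK; last first.
    by apply: gamma_integral_fin_num;
      rewrite (lt_le_trans (ltrN10 _))// mulr_ge0// ltW.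
  apply: gamma_integral_lb; rewrite ?powR_ge0 ?(ltW M0)// => x Mx _.
  by apply: ge0_ler_powR;
    rewrite ?nnegrE ?mulr_ge0 ?(ltW a0) ?(ltW Mx) ?(ltW M0)
      ?(ltW (lt_trans M0 Mx)).
apply: (@le_trans _ _ (expR (M + 1) * 2^-1 ^+ l * (M `^ (a * l%:R) * expR (- (M
  + 1))))).
  rewrite powRrM powR_mulrn ?powR_ge0// Ma [_ ^+ _ * expR _]mulrC mulrACA expRN
    divff ?gt_eqF ?expR_gt0// mul1r -exprMn.
  by rewrite lerXn2r ?nnegrE//; lra.
by apply: ler_wpM2l => //; rewrite mulr_ge0 ?expR_ge0// exprn_ge0// invr_ge0.
Qed.

Definition mittag_leffler_partial y : R^nat :=
  series (fun l : nat => y ^+ l / Gamma (1 + a * l%:R)).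

Lemma cvg_mittag_leffler y :
  mittag_leffler_partial y n @[n --> \oo] --> mittag_leffler a 1 y.
Proof.
have [C C0 HC] := mittag_leffler_term_geometric (normr_ge0 y).
apply: normed_cvg; apply: (@series_le_cvg _ _ (geometric C 2^-1)).
- by move=> n /=.
- by move=> n /=; rewrite mulr_ge0// exprn_ge0// invr_ge0.
- move=> n /=; apply: le_trans (HC n).
  by rewrite normrM normrX normfV [`|Gamma _|]gtr0_norm.
- by apply: is_cvg_geometric_series; rewrite ger0_norm ?invr_ge0//; lra.
Qed.

Lemma mittag_leffler_partial_bounded Y : 0 <= Y ->
  exists2 C, 0 <= C & forall y n, `|y| <= Y -> `|mittag_leffler_partial y n| <= C.
Proof.
move=> Y0; have [C C0 HC] := mittag_leffler_term_geometric Y0.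
exists (C * (1 - 2^-1)^-1); first by rewrite mulr_ge0// invr_ge0; lra.
move=> y n yY; rewrite /mittag_leffler_partial /series /=.
apply: le_trans (ler_norm_sum _ _ _) _.
apply: le_trans (@geometric_le_lim _ n C 2^-1 C0 _ _); last 2 first.
- by rewrite invr_gt0.
- by rewrite ger0_norm ?invr_ge0//; lra.
apply: ler_sum => l _ /=; apply: le_trans (HC l).
rewrite normrM normrX normfV [`|Gamma _|]gtr0_norm// ler_pM2r ?invr_gt0//.
by rewrite lerXn2r ?nnegrE.
Qed.

Lemma Gamma1 : Gamma 1 = 1 :> R.
Proof.
rewrite /Gamma /Rintegral integral_itv_obnd_cbnd; last first.
  apply/measurable_EFinP; apply: measurable_funTS; apply: measurable_funM.
    exact: measurable_powR.
  by apply: measurableT_comp => //; exact: measurable_funN.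
rewrite -[RHS]/(fine 1%:E) -(integral_exponential_pdf (ltr01 : 0 < 1 :> R)).
rewrite integral_mkcond; congr fine; apply: eq_integral => t _.
rewrite /exponential_pdf !patchE; case: ifPn => // _.
by rewrite subrr powRr0 !mul1r mulN1r.
Qed.

(** The fractional integral of order [a] of the [l]-th term of the series is,
    by the Beta integral, a multiple of its term of index [l.+1]; integrating
    term by term, the fractional integral of the whole series is the series
    without its constant term, up to a factor. *)
Lemma mittag_leffler_integral_eq (L x : R) : 0 < L -> 0 < x ->
  (\int[mu]_v (pos_pow (a - 1) (x - v) *
     (mittag_leffler a 1 (- (L * v `^ a)) * pos_pow 0 v))%:E =
   (Gamma a / L * (1 - mittag_leffler a 1 (- (L * x `^ a))))%:E)%E.
Proof.
move=> L0 x0; pose k v := pos_pow (a - 1) (x - v).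
have mk : measurable_fun setT k.
  by apply: measurableT_comp; [exact: measurable_pos_pow|exact: measurable_funB].
have k0 v : 0 <= k v by exact: pos_pow_ge0.
have Lx0 : 0 <= L * x `^ a by rewrite mulr_ge0 ?powR_ge0 ?ltW.
have am1 : -1 < a - 1 by rewrite ltrBrDr addNr.
pose e l v : \bar R := (k v * pos_pow (a * l%:R) v)%:E.
have me l : measurable_fun setT (e l) by exact: measurable_beta_integrand.
have al l : -1 < a * l%:R by rewrite (lt_le_trans (ltrN10 _))// mulr_ge0// ltW.
have ie l : mu.-integrable setT (e l).
  apply/integrableP; split; first exact: me.
  under eq_integral => v _ do rewrite gee0_abs ?lee_fin ?mulr_ge0 ?pos_pow_ge0//.
  by rewrite -/(beta_conv _ _ _) beta_conv_Gamma// ltry.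
pose c l := (- L) ^+ l / Gamma (1 + a * l%:R).
pose S n v := (k v * (mittag_leffler_partial (- (L * v `^ a)) n * pos_pow 0
  v))%:E.
have SE n v : S n v = (\sum_(l < n) (c l)%:E * e l v)%E.
  rewrite /S /mittag_leffler_partial /series /= big_mkord.
  under [RHS]eq_bigr do rewrite -EFinM.
  rewrite sumEFin; congr EFin; rewrite mulr_suml mulr_sumr.
  apply: eq_bigr => l _; rewrite /c /pos_pow; case: ifPn => v0;
    last by rewrite !mulr0.
  rewrite powRr0 mulr1 -mulNr exprMn -(powR_mulrn l (powR_ge0 v a)) -powRrM; ring.
have iS n : (\int[mu]_v S n v = (Gamma a / L *
    (1 - mittag_leffler_partial (- (L * x `^ a)) n.+1))%:E)%E.
  under eq_integral do rewrite SE.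
  rewrite integral_sum//; last by move=> l; exact: integrableZl.
  under eq_bigr => l _.
    rewrite integralZl// -/(beta_conv _ _ _) beta_conv_Gamma// -EFinM.
    over.
  rewrite sumEFin; congr EFin; rewrite /mittag_leffler_partial /series /=.
  rewrite big_mkord big_ord_recl /= expr0 mulr0 addr0.
  rewrite Gamma1 divr1 opprD addrA subrr add0r mulrN mulr_sumr -sumrN.
  apply: eq_bigr => l _; rewrite /c /pos_pow x0 /bump leq0n add1n.
  have -> : a - 1 + a * l%:R + 1 = a * l.+1%:R by rewrite -addn1 natrD; ring.
  have -> : a - 1 + a * l%:R + 2 = 1 + a * l.+1%:R by rewrite -addn1 natrD; ring.
  rewrite subrK [a * l%:R + 1]addrC powRrM powR_mulrn ?powR_ge0// -(mulNr L)
    exprMn !exprS.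
  by field; rewrite !gt_eqF.
have [C C0 HC] := mittag_leffler_partial_bounded Lx0.
have kLx v n : `|k v * (mittag_leffler_partial (- (L * v `^ a)) n * pos_pow 0
  v)| <=
    C * (k v * pos_pow 0 v).
  rewrite /k {1 3}/pos_pow subr_gt0; case: ifPn => [vx|_];
    last by rewrite !mul0r normr0 mulr0.
  rewrite /pos_pow; case: ifPn => [v0|_]; last by rewrite !mulr0 normr0.
  rewrite powRr0 !mulr1 normrM mulrC (ger0_norm (powR_ge0 _ _)).
  apply: ler_wpM2r; first exact: powR_ge0.
  apply: HC; rewrite normrN ger0_norm ?mulr_ge0 ?powR_ge0 ?(ltW L0)//.
  apply: ler_wpM2l; first exact: ltW.
  by apply: ge0_ler_powR; rewrite ?nnegrE ?(ltW a0) ?(ltW v0) ?(ltW x0) ?(ltW vx).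
have mS n : measurable_fun setT (S n).
  rewrite (_ : S n = fun v => (\sum_(l < n) (c l)%:E * e l v)%E);
    last exact/funext.
  by apply: emeasurable_sum => l; apply: measurable_funeM.
have cS v : S n v @[n --> \oo] -->
    (k v * (mittag_leffler a 1 (- (L * v `^ a)) * pos_pow 0 v))%:E.
  apply/fine_cvgP; split; first by apply: nearW.
  apply: cvgMr; apply: cvgMl; exact: cvg_mittag_leffler.
pose F v := (k v * (mittag_leffler a 1 (- (L * v `^ a)) * pos_pow 0 v))%:E.
have [|||||_ _ cI] := @dominated_convergence _ _ R mu setT measurableT S F
  (fun v => (C%:E * e 0%N v)%E).
- exact: mS.
- by apply: (emeasurable_fun_cvg S) => // v _; exact: cS.
- by apply: aeW => v _; exact: cS.
- exact: integrableZl.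
- by apply: aeW => v n _; rewrite /e mulr0 -EFinM lee_fin; exact: kLx.
rewrite -/(F _) -(cvg_lim _ cI)//.
apply: cvg_lim => //=; under eq_fun do rewrite iS.
apply/fine_cvgP; split; first by apply: nearW.
apply: cvgMr; apply: cvgB; first exact: cvg_cst.
have := @cvg_mittag_leffler (- (L * x `^ a)).
by rewrite -cvg_shiftS.
Qed.

End mittag_leffler.

(** * Tail asymptotics from the fractional integral equation *)

Lemma le0_ger_powR {R : realType} (b x y : R) : b <= 0 -> 0 < x -> x <= y ->
  y `^ b <= x `^ b.
Proof.
move=> b0 x0 xy; have y0 : 0 < y by exact: lt_le_trans xy.
rewrite -(opprK b) 2![_ `^ - - b]powRN lef_pV2 ?posrE ?powR_gt0//.
by apply: ge0_ler_powR; rewrite ?nnegrE ?oppr_ge0 ?(ltW x0) ?(ltW y0).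
Qed.

Section tail_bounds.
Context {R : realType}.
Local Notation mu := (@lebesgue_measure R).
Variables (a K : R) (F : R -> R).
Hypotheses (a0 : 0 < a) (a1 : a < 1) (K0 : 0 < K).
Hypothesis F_noninc : forall x y, x <= y -> F y <= F x.
Hypothesis F_ge0 : forall x, 0 <= F x.
Hypothesis F_eq : forall x, 0 < x ->
  (\int[mu]_v (pos_pow (a - 1) (x - v) * (F v * pos_pow 0 v))%:E =
   (K * (1 - F x))%:E)%E.

Let mF : measurable_fun setT F.
Proof. by apply: nonincreasing_measurable => // x y _ _; exact: F_noninc. Qed.

Let mFpos : measurable_fun setT (fun v => F v * pos_pow 0 v).
Proof. by apply: measurable_funM => //; exact: measurable_pos_pow. Qed.

Let mk b x : measurable_fun setT (fun v : R => pos_pow b (x - v)).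
Proof.
by apply: measurableT_comp; [exact: measurable_pos_pow|exact: measurable_funB].
Qed.

Let mkF x : measurable_fun setT
  (fun v : R => (pos_pow (a - 1) (x - v) * (F v * pos_pow 0 v))%:E).
Proof.
by apply/measurable_EFinP; apply: measurable_funM; [exact: mk|exact: mFpos].
Qed.

Let mFk x : measurable_fun setT
  (fun v : R => (F v * pos_pow 0 v * pos_pow 0 (x - v))%:E).
Proof.
by apply/measurable_EFinP; apply: measurable_funM; [exact: mFpos|exact: mk].
Qed.

(** The kernel is at least [x `^ (a - 1)] on the interval from 0 to [x], and the
    whole fractional integral is at most [K]. *)
Lemma truncated_tail_integral_le x : 0 < x ->
  (\int[mu]_v (F v * pos_pow 0 v * pos_pow 0 (x - v))%:E <=
   (K * x `^ (1 - a))%:E)%E.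
Proof.
move=> x0.
apply: (@le_trans _ _ (\int[mu]_v ((x `^ (1 - a))%:E *
    (pos_pow (a - 1) (x - v) * (F v * pos_pow 0 v))%:E))%E).
  apply: ge0_le_integral => //.
  - by move=> v _; rewrite lee_fin !mulr_ge0 ?pos_pow_ge0.
  - exact: mFk.
  - by apply: measurable_funeM; exact: mkF.
  move=> v _; rewrite -EFinM lee_fin.
  have [v0|v0] := leP v 0.
    by rewrite /(pos_pow 0 v) ltNge v0 !(mulr0, mul0r).
  rewrite (_ : x `^ _ * _ =
    F v * (pos_pow 0 v * (x `^ (1 - a) * pos_pow (a - 1) (x - v)))); last by ring.
  rewrite -(mulrA (F v)) ler_wpM2l//.
  rewrite /pos_pow v0 subr_gt0; case: ifPn => [vx|_]; last by rewrite !mulr0.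
  have xv0 : 0 < x - v by rewrite subr_gt0.
  rewrite !powRr0 mulr1 mul1r.
  have {1}-> : 1 = x `^ (1 - a) * x `^ (a - 1).
    by rewrite -powRD ?(gt_eqF x0) ?implybT// addrA subrK subrr powRr0.
  rewrite ler_wpM2l ?powR_ge0// le0_ger_powR ?subr_le0 ?(ltW a1)//.
  by rewrite gerBl ltW.
rewrite ge0_integralZl//; last 3 first.
- exact: mkF.
- by move=> v _; rewrite lee_fin !mulr_ge0 ?pos_pow_ge0.
- by rewrite lee_fin powR_ge0.
rewrite F_eq// -EFinM lee_fin mulrC ler_wpM2r ?powR_ge0//.
by rewrite ler_piMr ?gerBl// ltW.
Qed.

Let B := Gamma a * Gamma 1 / Gamma (a + 1) :> R.

Let B0 : 0 < B.
Proof. by rewrite divr_gt0 ?mulr_gt0 ?Gamma_gt0 ?addr_gt0. Qed.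

Let kernel_integral x : 0 < x ->
  (\int[mu]_v (pos_pow (a - 1) (x - v) * pos_pow 0 v)%:E = (x `^ a * B)%:E)%E.
Proof.
move=> x0; have am1 : -1 < a - 1 by rewrite ltrBrDr addNr.
rewrite -/(beta_conv _ _ _) beta_conv_Gamma// addr0 subrK add0r /pos_pow x0 /B.
by have -> : a - 1 + 2 = a + 1 by ring.
Qed.

(** As [F] is nonincreasing, its fractional integral at [x] is at least [F x]
    times the integral of the kernel. *)
Lemma tail_le_powR x : 0 < x -> F x * (x `^ a * B) <= K.
Proof.
move=> x0; rewrite -lee_fin EFinM -kernel_integral//.
rewrite -ge0_integralZl_EFin//; last 2 first.
- by move=> v _; rewrite lee_fin !mulr_ge0 ?pos_pow_ge0.
- exact: measurable_beta_integrand.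
apply: (@le_trans _ _ (K * (1 - F x))%:E); last first.
  by rewrite lee_fin ler_piMr ?gerBl// ltW.
rewrite -F_eq//; apply: ge0_le_integral => //.
- by move=> v _; rewrite -EFinM lee_fin !mulr_ge0 ?pos_pow_ge0.
- by apply: measurable_funeM; exact: measurable_beta_integrand.
- exact: mkF.
move=> v _; rewrite -EFinM lee_fin mulrCA; rewrite {1 3}/pos_pow.
case: ifPn => [xv|_]; last by rewrite !mul0r.
rewrite ler_wpM2l ?powR_ge0// ler_wpM2r ?pos_pow_ge0// F_noninc//.
by rewrite ltW// -subr_gt0.
Qed.

(** Splitting the fractional integral at [d * x]: the part below is small for
    small [d] by the bound on the integrated tail, hence the part above, where
    [F] is at most [F (d * x)], cannot be small. *)
Lemma tail_ge_powR :
  exists c y0, [/\ 0 < c, 0 < y0 & forall y, y0 <= y -> c * y `^ (- a) <= F y].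
Proof.
(* [r] makes the bound on the integral below [d * x] a quarter of [K] *)
pose r : R := 4^-1 `^ (1 - a)^-1.
have r0 : 0 < r by rewrite powR_gt0.
have ra : r `^ (1 - a) = 4^-1.
  by rewrite -powRrM mulVf ?gt_eqF ?subr_gt0// powRr1.
pose d := r / (1 + r).
have d0 : 0 < d by rewrite divr_gt0// addr_gt0.
have dr : 1 - d = (1 + r)^-1 by rewrite /d; field; rewrite gt_eqF// addr_gt0.
have d10 : 0 < 1 - d by rewrite dr invr_gt0 addr_gt0.
have main x : 0 < x ->
    K * (1 - F x) <= K * 4^-1 + F (d * x) * (x `^ a * B).
  move=> x0; rewrite -lee_fin -F_eq// EFinD.
  pose q := ((1 - d) * x) `^ (a - 1).
  have q0 : 0 <= q by exact: powR_ge0.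
  have dx0 : 0 < d * x by rewrite mulr_gt0.
  have m1 := mFk (d * x); have m2 := measurable_beta_integrand (a - 1) 0 x.
  apply: (@le_trans _ _ (\int[mu]_v
     (q%:E * (F v * pos_pow 0 v * pos_pow 0 (d * x - v))%:E +
      (F (d * x))%:E * (pos_pow (a - 1) (x - v) * pos_pow 0 v)%:E))%E).
    apply: ge0_le_integral => //.
    - by move=> v _; rewrite lee_fin !mulr_ge0 ?pos_pow_ge0.
    - exact: mkF.
    - by apply: emeasurable_funD; apply: measurable_funeM.
    move=> v _; rewrite -!EFinM -EFinD lee_fin.
    have [v0|v0] := leP v 0;
      first by rewrite /(pos_pow 0 v) ltNge v0 !(mulr0, mul0r, addr0).
    have pv : pos_pow 0 v = 1 by rewrite /pos_pow v0 powRr0.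
    rewrite pv !mulr1; have [dxv|vdx] := leP (d * x) v.
      apply: ler_wpDl; first by rewrite !mulr_ge0 ?pos_pow_ge0.
      by rewrite mulrC ler_wpM2r ?pos_pow_ge0 ?F_noninc.
    apply: ler_wpDr; first by rewrite mulr_ge0 ?pos_pow_ge0.
    rewrite {2}/pos_pow subr_gt0 vdx powRr0 mulr1 ler_wpM2r//.
    have h : (1 - d) * x < x - v by rewrite mulrBl mul1r ltrD2l ltrN2.
    rewrite /pos_pow (lt_trans _ h) ?mulr_gt0// /q.
    by rewrite le0_ger_powR ?subr_le0 ?(ltW a1) ?mulr_gt0 ?(ltW h).
  rewrite ge0_integralD//; last 4 first.
  - by move=> v _; rewrite -EFinM lee_fin !mulr_ge0 ?pos_pow_ge0.
  - exact: measurable_funeM.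
  - by move=> v _; rewrite -EFinM lee_fin !mulr_ge0 ?pos_pow_ge0.
  - exact: measurable_funeM.
  apply: leeD.
    rewrite ge0_integralZl_EFin//; last by move=> v _;
      rewrite lee_fin !mulr_ge0 ?pos_pow_ge0.
    apply: (@le_trans _ _ (q%:E * (K * (d * x) `^ (1 - a))%:E)%E).
      by apply: lee_wpmul2l; [rewrite lee_fin|exact: truncated_tail_integral_le].
    rewrite -EFinM lee_fin mulrCA ler_wpM2l ?(ltW K0)// /q.
    have e0 : 0 < (1 - d) * x by rewrite mulr_gt0.
    have -> : d * x = r * ((1 - d) * x) by rewrite dr mulrA.
    rewrite powRM ?(ltW r0) ?(ltW e0)// ra mulrCA -powRD ?(gt_eqF e0) ?implybT//.
    by rewrite addrA subrK subrr powRr0 mulr1.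
  rewrite ge0_integralZl_EFin//; last by move=> v _;
    rewrite lee_fin !mulr_ge0 ?pos_pow_ge0.
  by rewrite kernel_integral// -EFinM.
(* from [x0] on, [tail_le_powR] gives [F x <= 1 / 2] *)
pose x0 := (2 * K / B) `^ a^-1.
have x00 : 0 < x0 by rewrite powR_gt0// divr_gt0// mulr_gt0.
exists (K / (4 * B) * d `^ a), (d * x0); split.
- by rewrite mulr_gt0 ?powR_gt0// divr_gt0// mulr_gt0.
- by rewrite mulr_gt0.
move=> y yx0; pose x := y / d.
have xx0 : x0 <= x by rewrite /x ler_pdivlMr// mulrC.
have xpos : 0 < x by exact: lt_le_trans xx0.
have yE : y = d * x by rewrite /x mulrCA divff ?gt_eqF// mulr1.
have xa : 2 * K / B <= x `^ a.
  have <- : x0 `^ a = 2 * K / B.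
    rewrite -powRrM mulVf ?gt_eqF// powRr1//.
    by apply: divr_ge0; [apply: mulr_ge0 => //; exact: ltW|exact: ltW].
  by apply: ge0_ler_powR; rewrite ?nnegrE ?(ltW a0) ?(ltW x00) ?(ltW xpos).
have xaB : 2 * K <= x `^ a * B by rewrite -ler_pdivrMr.
have Fx : F x <= 2^-1.
  have h : F x * (2 * K) <= K.
    by apply: le_trans (tail_le_powR xpos); rewrite ler_wpM2l.
  by rewrite -(ler_pM2r K0); lra.
have := main x xpos.
have xa0 : 0 < x `^ a by rewrite powR_gt0.
have da0 : 0 < d `^ a by rewrite powR_gt0.
rewrite yE powRN powRM ?(ltW d0) ?(ltW xpos)//.
have -> : K / (4 * B) * d `^ a * (d `^ a * x `^ a)^-1 = K / (4 * B) / x `^ a.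
  by field; rewrite !gt_eqF.
have KFx : K * F x <= K * 2^-1 by rewrite ler_pM2l.
have B4 : 0 < 4 * B by rewrite mulr_gt0.
move=> h; rewrite ler_pdivrMr// ler_pdivrMr//.
lra.
Qed.

End tail_bounds.

(** * Partial sums of Mittag-Leffler variables *)

Section mittag_leffler_rv.
Context d (T : measurableType d) (R : realType) (P : probability T R).
Local Notation mu := (@lebesgue_measure R).
Variables (a lambda : R).
Hypotheses (a0 : 0 < a) (a1 : a < 1) (lambda0 : 0 < lambda).

Let L := lambda `^ a.
Let L0 : 0 < L. Proof. exact: powR_gt0. Qed.
Let K := Gamma a / L.
Let K0 : 0 < K. Proof. by rewrite divr_gt0// Gamma_gt0. Qed.

Definition tail (X : {RV P >-> R}) (x : R) : R := fine (P [set w | x < X w]).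

Lemma measurable_tail_set (X : {RV P >-> R}) x : measurable [set w | x < X w].
Proof.
rewrite (_ : [set w | x < X w] = X @^-1` `]x, +oo[%classic).
  exact: measurable_funPTI.
by apply/seteqP; split => w /=; rewrite in_itv /= andbT.
Qed.

Lemma tailE (X : {RV P >-> R}) x : P [set w | x < X w] = (tail X x)%:E.
Proof. by rewrite /tail fineK// fin_num_measure//;
  exact: measurable_tail_set. Qed.

Lemma tail_ge0 (X : {RV P >-> R}) x : 0 <= tail X x.
Proof. by rewrite fine_ge0. Qed.

Lemma tail_le1 (X : {RV P >-> R}) x : tail X x <= 1.
Proof. by rewrite -lee_fin -tailE probability_le1//;
  exact: measurable_tail_set. Qed.

Lemma tail_noninc (X : {RV P >-> R}) x y : x <= y -> tail X y <= tail X x.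
Proof.
move=> xy; rewrite -lee_fin -!tailE; apply: le_measure; rewrite ?inE.
- exact: measurable_tail_set.
- exact: measurable_tail_set.
- by move=> w /=; exact: le_lt_trans.
Qed.

Section one_variable.
Variables (X : {RV P >-> R}) (hX : mittag_leffler_rv a lambda X).

(** The integral equation only involves positive arguments, where the tail is
    the Mittag-Leffler function. *)
Lemma tail_integral_eq x : 0 < x ->
  (\int[mu]_v (pos_pow (a - 1) (x - v) * (tail X v * pos_pow 0 v))%:E =
   (K * (1 - tail X x))%:E)%E.
Proof.
have tE y : 0 <= y -> tail X y = mittag_leffler a 1 (- (L * y `^ a)).
  by move=> y0; rewrite /tail hX.2.
move=> x0; rewrite [in RHS]tE ?ltW// -(mittag_leffler_integral_eq a0 L0 x0).
apply: eq_integral => v _; congr EFin.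
have [v0|v0] := leP v 0; first by rewrite /(pos_pow 0 v) ltNge v0 !mulr0.
by rewrite tE// ltW.
Qed.

Definition truncate (t : R) : {RV P >-> R} :=
  min_mfun (max_mfun X (cst 0)) (cst t).

Lemma truncateE t w : truncate t w = Num.min (Num.max (X w) 0) t.
Proof. by []. Qed.

(** The expectation of a nonnegative variable is the integral of its tail, and
    truncation at [t] cuts the tail off at [t].  The positive part makes the
    truncation nonnegative everywhere, not just almost surely. *)
Lemma expectation_truncate_le t : 0 < t ->
  (\int[P]_w (truncate t w)%:E <= (K * t `^ (1 - a))%:E)%E.
Proof.
move=> t0.
have Y0 w : 0 <= truncate t w by rewrite truncateE le_min le_max lexx orbT ltW.
have := ge0_expectation_ccdf Y0; rewrite expectation_def => ->.
apply: le_trans (truncated_tail_integral_le a1 K0 (tail_noninc X) (tail_ge0 X)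
  tail_integral_eq t0).
rewrite -integral_itv_obnd_cbnd; last by apply: measurable_funTS;
  exact: ccdf_measurable.
rewrite integral_mkcond; apply: ge0_le_integral => //.
- by move=> r _; apply: erestrict_ge0 => s _; exact: measure_ge0.
- apply/(measurable_restrictT _ (measurable_itv _)).
  by apply: measurable_funTS; exact: ccdf_measurable.
- apply/measurable_EFinP; apply: measurable_funM.
    apply: measurable_funM; last exact: measurable_pos_pow.
    apply: nonincreasing_measurable => // x y; exact: tail_noninc.
  apply: measurableT_comp; first exact: measurable_pos_pow.
  exact: measurable_funB.
move=> r _; rewrite patchE; case: ifPn => [|_]; last first.
  by rewrite lee_fin !mulr_ge0 ?tail_ge0 ?pos_pow_ge0.
rewrite inE /= in_itv /= andbT => r0.
rewrite /pos_pow r0 subr_gt0 !powRr0 mulr1; case: ifPn => [rt|tr].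
  rewrite mulr1 -tailE /ccdf /distribution /pushforward.
  apply: le_measure; rewrite ?inE.
  - exact: measurable_funPTI.
  - exact: measurable_tail_set.
  - move=> w /=; rewrite in_itv /= andbT lt_min rt andbT lt_max.
    by rewrite [r < 0]ltNge (ltW r0) orbF.
rewrite mulr0 /ccdf /distribution /pushforward (_ : _ @^-1` _ = set0) ?measure0//.
rewrite -subset0 => w /=; rewrite in_itv /= andbT lt_min.
by rewrite (negbTE tr) andbF.
Qed.

Lemma tail_lower_bound :
  exists c y0, [/\ 0 < c, 0 < y0 &
    forall y, y0 <= y -> c * y `^ (- a) <= tail X y].
Proof.
exact: (tail_ge_powR a0 a1 K0 (tail_noninc X) (tail_ge0 X) tail_integral_eq).
Qed.

End one_variable.

Section sums.
Variable (X : nat -> {RV P >-> R}).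
Hypothesis hX : forall n, mittag_leffler_rv a lambda (X n).

Lemma measurable_sumX n : measurable_fun setT (fun w => \sum_(i < n) X i w).
Proof. by apply: measurable_sum => i. Qed.

Lemma measurable_sumX_gt n t : measurable [set w | t < \sum_(i < n) X i w].
Proof.
rewrite -[X in measurable X]setTI.
have := @measurable_fun_ltr _ _ R setT (cst t) _ (measurable_cst _)
  (measurable_sumX n).
by move=> /(_ measurableT [set true]) => /(_ I).
Qed.

Lemma measurable_sumX_le n t : measurable [set w | \sum_(i < n) X i w <= t].
Proof.
rewrite (_ : mkset _ = ~` [set w | t < \sum_(i < n) X i w]).
  by apply: measurableC; exact: measurable_sumX_gt.
by apply/seteqP; split => w /=; rewrite leNgt => /negP.
Qed.

(** Where the sum exceeds [t], so does, weakly, the sum of the summands truncated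
    at [t], and to the latter the Markov inequality applies although the summands
    themselves have infinite mean. *)
Lemma prob_sum_gt_le n t : 0 < t ->
  (P [set w | t < \sum_(i < n) X i w]%R <= (K * n%:R * t `^ (- a))%:E)%E.
Proof.
move=> t0; set A := [set w | _].
have mA : measurable A by exact: measurable_sumX_gt.
have Y0 i w : 0 <= truncate (X i) t w
  by rewrite truncateE le_min le_max lexx orbT ltW.
have AY w : A w -> t <= \sum_(i < n) truncate (X i) t w.
  rewrite /A /= => tS; have [[i ti]|noti] := pselect (exists i : 'I_n, t < X i w).
    rewrite (bigD1 i)// -[leLHS]addr0; apply: lerD;
      last by apply: sumr_ge0 => j _; exact: Y0.
    by rewrite min_r// le_max (ltW ti).
  apply: le_trans (ltW tS) _; apply: ler_sum => i _.
  rewrite ?truncateE le_min le_max lexx /= leNgt; apply/negP => ti.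
  by apply: noti; exists i.
have mY i : measurable_fun setT (fun w => (truncate (X i) t w)%:E).
  exact/measurable_EFinP.
have : (t%:E * P A <= (n%:R * (K * t `^ (1 - a)))%:E)%E.
  apply: (@le_trans _ _ (\int[P]_w (\sum_(i < n) (truncate (X i) t w)%:E))%E).
    rewrite -(integral_cst P mA t%:E) integral_mkcond;
      apply: ge0_le_integral => //.
    - by move=> w _; apply: erestrict_ge0 => ? _; rewrite lee_fin ltW.
    - by apply/(measurable_restrictT _ mA); exact: measurable_cst.
    - by apply: emeasurable_sum => i; exact: mY.
    move=> w _; rewrite patchE sumEFin; case: ifPn => [|_].
      by rewrite inE => /AY; rewrite lee_fin.
    by rewrite lee_fin; apply: sumr_ge0 => i _; exact: Y0.
  rewrite ge0_integral_sum//; last by move=> i w _; rewrite lee_fin.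
  apply: (@le_trans _ _ (\sum_(i < n) (K * t `^ (1 - a))%:E)%E).
    by apply: lee_sum => i _; exact: expectation_truncate_le.
  by rewrite sumEFin lee_fin sumr_const card_ord mulr_natl.
have -> : P A = (fine (P A))%:E by rewrite fineK// fin_num_measure.
rewrite -EFinM !lee_fin => h; rewrite -(ler_pM2l t0); apply: (le_trans h).
have -> : t `^ (1 - a) = t * t `^ (- a).
  by rewrite powRD ?(gt_eqF t0) ?implybT// powRr1// ltW.
by rewrite le_eqVlt; apply/orP; left; apply/eqP; ring.
Qed.

(** The sum of positive variables is at least each of them, and all of [n]
    independent variables are below [t] with a probability exponentially small
    in [n] times the tail at [t]. *)
Lemma prob_sum_le_le : mutually_independent X ->
  exists c t0, [/\ 0 < c, 0 < t0 & forall n t, t0 <= t ->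
    (P [set w | \sum_(i < n) X i w <= t]%R <=
     (expR (- (c * n%:R * t `^ (- a))))%:E)%E].
Proof.
move=> indX.
have tailX i x : 0 <= x -> tail (X i) x = tail (X 0%N) x.
  by move=> x0; rewrite /tail (hX i).2// (hX 0%N).2.
have [c [t0 [c0 t00 tl]]] := tail_lower_bound (hX 0%N).
exists c, t0; split => // n t t0t.
have tpos : 0 < t by exact: lt_le_trans t0t.
pose E := \big[setI/setT]_(i <- iota 0 n) (X i @^-1` `]-oo, t]%classic).
have PE : (P E <= (expR (- (c * n%:R * t `^ (- a))))%:E)%E.
  rewrite /E (indX (iota 0 n) (fun=> `]-oo, t]%classic) (iota_uniq _ _)
    (fun=> measurable_itv _)).
  rewrite (_ : - _ = n%:R * - (c * t `^ (- a))); last by ring.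
  rewrite expRM_natl.
  have cdfE i : P (X i @^-1` `]-oo, t]%classic) = (1 - tail (X 0%N) t)%:E.
    rewrite EFinB -(tailX i) ?(ltW tpos)// -tailE -probability_setC;
      last exact: measurable_tail_set.
    congr (P _); apply/seteqP; split => w /=; rewrite in_itv /= leNgt.
      by move=> /negP.
    by move=> /negP.
  under eq_bigr do rewrite cdfE.
  have prodE k m : (\prod_(i <- iota m k) (1 - tail (X 0%N) t)%:E =
      ((1 - tail (X 0%N) t) ^+ k)%:E)%E.
    elim: k m => [|k IH] m /=; first by rewrite big_nil expr0.
    by rewrite big_cons IH -EFinM exprS.
  rewrite prodE lee_fin lerXn2r ?nnegrE ?expR_ge0 ?subr_ge0 ?tail_le1//.
  apply: le_trans (expR_ge1Dx _); rewrite lerD2l lerN2; exact: tl.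
have mE : measurable E.
  by apply: bigsetI_measurable => i _; exact: measurable_funPTI.
have aepos : {ae P, forall w, forall i, 0 < X i w}.
  by apply/ae_foralln => i; have [] := hX i.
have [N [mN N0 subN]] := aepos.
have mS := measurable_sumX_le n t.
apply: (@le_trans _ _ (P (E `|` N))).
  apply: le_measure; rewrite ?inE//; first exact: measurableU.
  move=> w /= Sw; have [Nw|Nw] := pselect (N w); [by right|left].
  have posw : forall i, 0 < X i w.
    by apply: contrapT => h; apply: Nw; apply: subN.
  rewrite /E -bigcap_seq => i /=; rewrite mem_iota add0n /= => ilt.
  rewrite in_itv /=; apply: le_trans Sw.
  rewrite (bigD1 (Ordinal ilt))//= lerDl; apply: sumr_ge0 => j _; exact: ltW.
by rewrite measureU0.
Qed.

End sums.
End mittag_leffler_rv.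

(** * Comparison of two renewal sequences *)

Section comparison.
Context d (T : measurableType d) (R : realType) (P : probability T R).

(** The intersection of a tail of the sequence is at most as likely as the least
    likely of its members. [P (A n)] need not be summable: the claim is only that
    infinitely many [A n] fail, not that all but finitely many do. *)
Lemma ae_infinitely_often_not (A : nat -> set T) :
  (forall n, measurable (A n)) ->
  (forall (e : R) m, 0 < e -> exists2 n, (m <= n)%N & (P (A n) <= e%:E)%E) ->
  {ae P, forall w, forall m, exists2 n, (m <= n)%N & ~ A n w}.
Proof.
move=> mA PA; apply: ae_foralln => m.
exists (\bigcap_(n in [set n | (m <= n)%N]) A n); split.
- by apply: bigcap_measurable => //; exists m => /=.
- apply/eqP; rewrite eq_le measure_ge0 andbT; apply/lee_addgt0Pr => e e0.
  have [n mn Pn] := PA e m e0; rewrite add0e; apply: le_trans Pn.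
  apply: le_measure; rewrite ?inE//; last exact: bigcap_inf.
  by apply: bigcap_measurable => //; exists m => /=.
- move=> w /= nw n mn; apply: contrapT => nA; apply: nw.
  by exists n.
Qed.

Lemma expRN_le_inv (x : R) : 0 < x -> expR (- x) <= x^-1.
Proof.
move=> x0; rewrite expRN lef_pV2 ?posrE ?expR_gt0//.
by apply: le_trans (expR_ge1Dx x); rewrite lerDr.
Qed.

Lemma renewals_unbounded (a lambda : R) (X : nat -> {RV P >-> R}) :
  0 < a -> a < 1 -> 0 < lambda ->
  mutually_independent X -> (forall n, mittag_leffler_rv a lambda (X n)) ->
  {ae P, forall w, forall t : R, exists n, t < \sum_(i < n) X i w}.
Proof.
move=> a0 a1 l0 indX hX.
have [c [t0 [c0 t00 Hc]]] := prob_sum_le_le a0 a1 l0 hX indX.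
have : {ae P, forall w, forall k : nat, forall m, exists2 n, (m <= n)%N &
    ~ [set w | \sum_(i < n) X i w <= t0 + k%:R] w}.
  apply: ae_foralln => k; apply: ae_infinitely_often_not.
    by move=> n; exact: measurable_sumX_le.
  move=> e m e0; pose t := t0 + k%:R.
  have tt0 : t0 <= t by rewrite /t lerDl.
  pose q := c * t `^ (- a).
  have q0 : 0 < q by rewrite mulr_gt0// powR_gt0// (lt_le_trans t00).
  pose n := maxn m (Num.bound (q * e)^-1).
  have qe : 0 < q * e by rewrite mulr_gt0.
  have nb : (q * e)^-1 < n%:R.
    apply: lt_le_trans (archi_boundP _) _; first by rewrite invr_ge0 ltW.
    by rewrite ler_nat leq_maxr.
  exists n; first exact: leq_maxl.
  apply: (le_trans (Hc n t tt0)); rewrite lee_fin.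
  have n0 : 0 < n%:R :> R by apply: lt_trans nb; rewrite invr_gt0.
  rewrite mulrAC -/q; apply: le_trans (expRN_le_inv _) _;
    first by rewrite mulr_gt0.
  rewrite invf_ple ?posrE //; last exact: mulr_gt0.
  by move: (ltW nb); rewrite invfM ler_pdivrMl.
move=> H0; apply: filterS H0 => w H t.
have [k tk] : exists k : nat, t < t0 + k%:R.
  exists (Num.bound `|t|); apply: le_lt_trans (ler_norm t) _.
  by rewrite ltr_wpDl ?(ltW t00)// archi_boundP.
have [n _ Hn] := H k 0%N; exists n; apply: (lt_trans tk).
by rewrite ltNge; apply/negP.
Qed.

(** At the time [n `^ (2 / (a + b))], which lies between the natural time
    scales [n `^ (1 / b)] and [n `^ (1 / a)] of the two sequences, the process
    with the heavier tail has very likely not reached [n] renewals while the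
    other has passed [2 n]. *)
Lemma renewals_apart (a b lambda mu : R) (X Y : nat -> {RV P >-> R}) :
  0 < a -> a < b -> b < 1 -> 0 < lambda -> 0 < mu ->
  mutually_independent X ->
  (forall n, mittag_leffler_rv a lambda (X n)) ->
  (forall n, mittag_leffler_rv b mu (Y n)) ->
  {ae P, forall w, forall m, exists n t, [/\ (m <= n)%N, n%:R <= t,
     t < \sum_(i < n) X i w & \sum_(i < n.*2) Y i w <= t]}.
Proof.
move=> a0 ab b1 l0 m0 indX hX hY.
have a1 : a < 1 by exact: lt_trans b1.
have b0 : 0 < b by exact: lt_trans ab.
have [c [t0 [c0 t00 Hc]]] := prob_sum_le_le a0 a1 l0 hX indX.
pose K := Gamma b / mu `^ b.
have K0 : 0 < K by rewrite divr_gt0 ?Gamma_gt0// powR_gt0.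
have Hd n t : 0 < t -> (P [set w | t < \sum_(i < n) Y i w]%R <= (K * n%:R * t
  `^ (- b))%:E)%E.
  by move=> tpos; exact: (prob_sum_gt_le b0 b1 m0 hY).
have ab0 : 0 < a + b by rewrite addr_gt0.
pose s := 2 / (a + b).
have s1 : 1 <= s by rewrite /s ler_pdivlMr// mul1r; lra.
(* at time [t n] both error bounds are at most multiples of [n `^ (- p)] *)
pose p := (b - a) / (a + b).
have p0 : 0 < p by rewrite divr_gt0// subr_gt0.
pose t (n : nat) : R := n%:R `^ s.
pose A n := [set w | \sum_(i < n) X i w <= t n] `|` [set w | t n < \sum_(i <
  n.*2) Y i w].
have tn n : (0 < n)%N -> n%:R <= t n.
  by move=> n0; apply: le1r_powR => //; rewrite ler1n.
pose C := c^-1 + 2 * K.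
have C0 : 0 < C by rewrite addr_gt0 ?invr_gt0// mulr_gt0.
have PA n : (0 < n)%N -> t0 <= n%:R -> (P (A n) <= (C * n%:R `^ (- p))%:E)%E.
  move=> n0 nt0; have n0' : 0 < n%:R :> R by rewrite ltr0n.
  apply: le_trans (measureU2 _ _ _) _;
    [exact: measurable_sumX_le|exact: measurable_sumX_gt|].
  have tna : n%:R * t n `^ (- a) = n%:R `^ p.
    rewrite -powRrM -[X in X * _]powRr1 ?ltW// -powRD ?(gt_eqF n0') ?implybT//.
    by congr (_ `^ _); rewrite /s /p; field; rewrite gt_eqF.
  have tnb : n%:R * t n `^ (- b) = n%:R `^ (- p).
    rewrite -powRrM -[X in X * _]powRr1 ?ltW// -powRD ?(gt_eqF n0') ?implybT//.
    by congr (_ `^ _); rewrite /s /p; field; rewrite gt_eqF.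
  apply: (@le_trans _ _ (((c * n%:R `^ p)^-1)%:E + (K * 2 * n%:R `^ (- p))%:E)%E).
    apply: leeD.
      apply: (le_trans (Hc _ _ (le_trans nt0 (tn _ n0)))).
      by rewrite lee_fin -mulrA tna expRN_le_inv// mulr_gt0// powR_gt0.
    apply: (le_trans (Hd _ _ (lt_le_trans n0' (tn _ n0)))).
    by rewrite lee_fin -muln2 natrM [n%:R * 2]mulrC mulrA -mulrA tnb.
  rewrite -EFinD lee_fin /C invfM -powRN mulrDl.
  by rewrite [K * 2]mulrC.
have : {ae P, forall w, forall m, exists2 n, (m <= n)%N & ~ A n w}.
  apply: ae_infinitely_often_not => [n|e m e0].
    by apply: measurableU; [exact: measurable_sumX_le|exact: measurable_sumX_gt].
  pose x := Num.max t0 ((C / e) `^ p^-1).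
  pose n := maxn m (Num.bound x).
  have xn : x <= n%:R.
    apply: ltW; apply: lt_le_trans (archi_boundP _) _;
      last by rewrite ler_nat leq_maxr.
    by rewrite le_max (ltW t00).
  have [t0n Cn] : t0 <= n%:R /\ (C / e) `^ p^-1 <= n%:R.
    by split; apply: le_trans xn; rewrite le_max lexx ?orbT.
  have n0 : (0 < n)%N by rewrite -(ltr0n R); exact: lt_le_trans t0n.
  exists n; first exact: leq_maxl.
  apply: le_trans (PA _ n0 t0n) _; rewrite lee_fin powRN.
  rewrite ler_pdivrMr ?powR_gt0 ?ltr0n// mulrC -ler_pdivrMr//.
  have <- : ((C / e) `^ p^-1) `^ p = C / e.
    by rewrite -powRrM mulVf ?gt_eqF// powRr1// ltW// divr_gt0.
  by apply: ge0_ler_powR; rewrite ?nnegrE ?powR_ge0 ?(ltW p0).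
move=> H0; apply: filterS H0 => w H m; have [n mn nA] := H m.+1.
exists n, (t n); split.
- exact: ltnW.
- by apply: tn; exact: leq_ltn_trans mn.
- by rewrite ltNge; apply/negP => h; apply: nA; left.
- by rewrite leNgt; apply/negP => h; apply: nA; right.
Qed.

End comparison.

(** * Sample paths *)

Section renewal_count.
Context d (T : measurableType d) (R : realType) (X : nat -> T -> R) (w : T).
Hypothesis X_gt0 : forall i, 0 < X i w.

Lemma le_partial_sum m n : (m <= n)%N -> \sum_(i < m) X i w <= \sum_(i < n) X i w.
Proof.
move=> mn; rewrite -!(big_mkord xpredT (fun i => X i w)) (big_cat_nat (leq0n m)
  mn) lerDl.
by apply: sumr_ge0 => i _; exact: ltW.
Qed.

Lemma renewal_count_le t n : t < \sum_(i < n.+1) X i w ->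
  (renewal_count X t w <= n%:R%:E)%E.
Proof.
move=> tS; apply: ge_ereal_sup => _ [k /= Sk <-]; rewrite lee_fin ler_nat leqNgt.
by apply/negP => nk; move: (lt_le_trans tS (le_partial_sum nk)); rewrite ltNge Sk.
Qed.

Lemma renewal_count_ge t n : \sum_(i < n) X i w <= t ->
  (n%:R%:E <= renewal_count X t w)%E.
Proof. by move=> St; apply: ereal_sup_ubound; exists n. Qed.

(** Rules out the value [+oo]. *)
Lemma renewal_count_nat t : 0 <= t -> (exists n, t < \sum_(i < n) X i w) ->
  exists k : nat, renewal_count X t w = k%:R%:E.
Proof.
move=> t0 [n tn].
have ex0 : exists k, \sum_(i < k) X i w <= t by exists 0%N; rewrite big_ord0.
have ub k : \sum_(i < k) X i w <= t -> (k <= n)%N.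
  move=> kt; rewrite leqNgt; apply/negP => /ltnW/le_partial_sum nk.
  by move: (lt_le_trans tn nk); rewrite ltNge kt.
case: (ex_maxnP ex0 ub) => k kt kmax; exists k.
apply/eqP; rewrite eq_le renewal_count_ge// andbT renewal_count_le//.
by rewrite ltNge; apply/negP => /kmax; rewrite ltnn.
Qed.

Lemma le_renewal_count s t : s <= t ->
  (renewal_count X s w <= renewal_count X t w)%E.
Proof.
move=> st; apply: ereal_sup_le => _ [k /= ks <-]; exists k => //=.
exact: le_trans st.
Qed.

Lemma renewal_count0 : renewal_count X 0 w = 0%E.
Proof.
apply/eqP; rewrite eq_le (@renewal_count_le 0 0) ?big_ord_recl ?big_ord0 ?addr0//.
by apply: (@renewal_count_ge 0 0); rewrite big_ord0.
Qed.

End renewal_count.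

Section queue_paths.
Context (T : Type) (R : realType) (N1 N2 : R -> T -> \bar R) (w : T).

(** Once the net input falls below all its values up to time [M], its minimum
    over a longer time interval is attained after [M], and the queue is empty
    at any time where the net input attains a new minimum.  Integrality of
    the counts guarantees that the minimum is attained. *)
Lemma queue_empties (p q : R -> nat) :
  (forall t, 0 <= t -> N1 t w = (p t)%:R%:E) ->
  (forall t, 0 <= t -> N2 t w = (q t)%:R%:E) ->
  (forall s t, 0 <= s -> s <= t -> (q s <= q t)%N) ->
  (forall k : nat, exists2 t, 0 <= t & (p t + k < q t)%N) ->
  forall M, exists t, [/\ 0 <= t, M <= t & queue_length N1 N2 t w = 0%E].
Proof.
move=> N1p N2q qmono drift M; pose M' := Num.max 0 M.
have M'0 : 0 <= M' by rewrite le_max lexx.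
have [t t0 pq] := drift (q M').
(* the net input on the interval up to [t], shifted to be a natural number *)
pose v s := (p s + (q t - q s))%N.
have ex : exists m, `[< exists s, [/\ 0 <= s, s <= t & v s = m] >].
  by exists (v t); apply/asboolP; exists t.
case: (ex_minnP ex) => m /asboolP[s [s0 st <-]] vmin.
have {}vmin r : 0 <= r -> r <= t -> (v s <= v r)%N.
  by move=> r0 rt; apply: vmin; apply/asboolP; exists r.
have M's : M' < s.
  rewrite ltNge; apply/negP => sM'.
  have := vmin t t0 (lexx t); have := qmono s M' s0 sM'; have := qmono s t s0 st.
  rewrite /v subnn addn0; lia.
exists s; split => //; first by apply: le_trans (ltW M's);
  rewrite le_max lexx orbT.
rewrite /queue_length N1p// N2q//.
suff -> : ereal_inf [set (N1 r w - N2 r w)%E | r in [set r : R | 0 <= r <= s]] =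
    ((p s)%:R%:E - (q s)%:R%:E)%E by rewrite subee// -EFinB.
apply/eqP; rewrite eq_le; apply/andP; split.
  apply: ereal_inf_lbound; exists s; first by rewrite /= s0 lexx.
  by rewrite N1p// N2q.
apply: le_ereal_inf_tmp => _ [r /= /andP[r0 rs] <-].
rewrite N1p// N2q// -!EFinB lee_fin.
have rt := le_trans rs st.
rewrite lerBlDr addrAC lerBrDr -!natrD ler_nat.
have := vmin r r0 rt; have := qmono s t s0 st; have := qmono r t r0 rt.
rewrite /v; lia.
Qed.

(** Both processes start at 0, so the infimum subtracted in the queue length is
    at most 0; the first count may be infinite here. *)
Lemma queue_length_ge (t : R) (n : nat) :
  0 <= t -> N1 0 w = 0%E -> N2 0 w = 0%E ->
  (n.*2%:R%:E <= N1 t w)%E -> (N2 t w <= n%:R%:E)%E ->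
  (n%:R%:E <= queue_length N1 N2 t w)%E.
Proof.
move=> t0 N10 N20 N1t N2t; rewrite /queue_length.
have inf0 : (ereal_inf [set (N1 s w - N2 s w)%E | s in [set s : R |
    (0 <= s <= t)%R]] <= 0)%E.
  apply: ereal_inf_lbound; exists 0; first by rewrite /= lexx t0.
  by rewrite N10 N20 sube0.
rewrite -[leLHS]sube0; apply: leeB => //.
have -> : n%:R%:E = (n.*2%:R%:E - n%:R%:E)%E :> \bar R.
  by rewrite -EFinB -addnn natrD addrK.
exact: leeB.
Qed.

End queue_paths.

Lemma ae_interarrival_gt0 d (T : measurableType d) (R : realType)
    (P : probability T R) (a lambda : R) (X : nat -> {RV P >-> R}) :
  (forall n, mittag_leffler_rv a lambda (X n)) ->
  {ae P, forall w, forall i, 0 < X i w}.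
Proof. by move=> hX; apply: ae_foralln => i; have [] := hX i. Qed.

Theorem theorem3p7 (R : realType) (d : measure_display)
    (T : measurableType d) (P : probability T R)
    (a1 a2 lambda mu : R) (N1 N2 : R -> T -> \bar R)
    (a1_01 : 0 < a1 < 1) (a2_01 : 0 < a2 < 1)
    (lambda_gt0 : 0 < lambda) (mu_gt0 : 0 < mu)
    (fppN1 : fractional_poisson_process P a1 lambda N1)
    (fppN2 : fractional_poisson_process P a2 mu N2)
    (indepN12 : independent_processes P N1 N2) :
  (a1 < a2 ->
     {ae P, forall w, forall M : R, exists t : R,
       [/\ 0 <= t, M <= t & queue_length N1 N2 t w = 0%E]}) /\
  (a2 < a1 ->
     {ae P, forall w,
       limf_esup (fun t : R => queue_length N1 N2 t w) (pinfty_nbhs R)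
         = +oo%E}).
Proof.
have [a10 a11] := andP a1_01; have [a20 a21] := andP a2_01.
have [X [indX hX N1E]] := fppN1; have [Y [indY hY N2E]] := fppN2.
have posX := ae_interarrival_gt0 hX; have posY := ae_interarrival_gt0 hY.
split=> a12.
  have apart := renewals_apart a10 a12 a21 lambda_gt0 mu_gt0 indX hX hY.
  have finX := renewals_unbounded a10 a11 lambda_gt0 indX hX.
  have finY := renewals_unbounded a20 a21 mu_gt0 indY hY.
  near=> w.
  have X0 : forall i, 0 < X i w by near: w.
  have Y0 : forall i, 0 < Y i w by near: w.
  have fX : forall t : R, exists n, t < \sum_(i < n) X i w by near: w.
  have fY : forall t : R, exists n, t < \sum_(i < n) Y i w by near: w.
  have XY : forall m, exists n t, [/\ (m <= n)%N, n%:R <= t,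
     t < \sum_(i < n) X i w & \sum_(i < n.*2) Y i w <= t] by near: w.
  have finE (N : R -> T -> \bar R) (Z : nat -> {RV P >-> R}) :
      (forall t w, 0 <= t -> N t w = renewal_count Z t w) ->
      (forall i, 0 < Z i w) -> (forall t : R, exists n, t < \sum_(i < n) Z i w) ->
      forall t, 0 <= t -> N t w = (Num.truncn (fine (N t w)))%:R%:E.
    move=> NE Z0 fZ t t0; rewrite NE//.
    by have [k ->] := @renewal_count_nat _ _ _ (fun i => Z i) w Z0 t t0 (fZ t);
      rewrite /= natrK.
  have E1 := finE _ _ N1E X0 fX; have E2 := finE _ _ N2E Y0 fY.
  apply: (queue_empties E1 E2) => [s t s0 st|k].
    have t0 := le_trans s0 st.
    rewrite -(ler_nat R) -lee_fin -!E2// !N2E//.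
    exact: le_renewal_count.
  have [n [t [kn nt tX Yt]]] := XY k.+1.
  have t0 : 0 <= t by apply: le_trans nt.
  exists t => //.
  have le1 : (Num.truncn (fine (N1 t w)) <= n)%N.
    rewrite -(ler_nat R) -lee_fin -E1// N1E//; apply: renewal_count_le => //.
    by apply: lt_le_trans tX _; exact: (le_partial_sum (X := fun i => X i)).
  have le2 : (n.*2 <= Num.truncn (fine (N2 t w)))%N.
    by rewrite -(ler_nat R) -lee_fin -E2// N2E//; exact: renewal_count_ge.
  by move: le1 le2 kn; lia.
have apart := renewals_apart a20 a12 a11 mu_gt0 lambda_gt0 indY hY hX.
near=> w.
have X0 : forall i, 0 < X i w by near: w.
have Y0 : forall i, 0 < Y i w by near: w.
have YX : forall m, exists n t, [/\ (m <= n)%N, n%:R <= t,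
   t < \sum_(i < n) Y i w & \sum_(i < n.*2) X i w <= t] by near: w.
rewrite /limf_esup; apply/eqP; rewrite eq_le leey /=.
apply: le_ereal_inf_tmp => _ [V [A [_ AV]] <-].
rewrite leye_eq; apply/eqP/eqyP => r r0.
have [n [t [mn nt tY Xt]]] := YX (maxn (Num.bound `|A|) (Num.bound r)).
have t0 : 0 <= t by apply: le_trans nt.
have An : A < n%:R.
  apply: le_lt_trans (ler_norm A) _; apply: lt_le_trans (archi_boundP _) _ => //.
  by rewrite ler_nat; apply: leq_trans mn; exact: leq_maxl.
have rn : r <= n%:R.
  apply: ltW; apply: lt_le_trans (archi_boundP (ltW r0)) _.
  by rewrite ler_nat; apply: leq_trans mn; exact: leq_maxr.
apply: (@le_trans _ _ (queue_length N1 N2 t w)); last first.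
  by apply: ereal_sup_ubound; exists t => //; apply: AV; exact: lt_le_trans nt.
apply: (@le_trans _ _ n%:R%:E); first by rewrite lee_fin.
apply: queue_length_ge => //.
- by rewrite N1E// renewal_count0.
- by rewrite N2E// renewal_count0.
- by rewrite N1E//; exact: renewal_count_ge.
- rewrite N2E//; apply: renewal_count_le => //.
  by apply: lt_le_trans tY _; exact: (le_partial_sum (X := fun i => Y i)).
Unshelve. all: end_near.
Qed.
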